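(* Let $p$ be a prime and let $g:\mathbb{N}\to\mathbb{C}$ be an arithmetic function with Bell exponents $\beta_g(m)=\frac1m\sum_{d\mid m}\mu(d)\,g(m/d)$, $m\ge1$. Let $a_g(n)$ be the coefficients of $$F_g(x)=\exp\left(-\sum_{n\ge1}\frac{g(n)}{n}x^n\right)=\sum_{n\ge0}a_g(n)x^n.$$ If $\beta_g(m)=0$ whenever $p\nmid m$, then $a_g(n)=0$ whenever $p\nmid n$.
   Context: $\mathbb{N}$ is the set of positive integers and $\mu$ is the Möbius function. $F_g(x)\in\mathbb{C}[[x]]$ is a formal power series, called the formal Bell transform of $g$. *)

(* Defs.v *)
From mathcomp Require Import all_boot all_order all_algebra.
From mathcomp Require Export complex reals.

Set Implicit Arguments.
Unset Strict Implicit.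
Unset Printing Implicit Defensive.

Import GRing.Theory.
Local Open Scope ring_scope.

Definition squarefree (n : nat) : bool :=
  all (fun q => logn q n == 1%N) (primes n).

Definition mobius (n : nat) : int :=
  if squarefree n then (-1) ^+ size (primes n) else 0.

(* A formal power series sum_n f_n x^n is its coefficient sequence f. *)
Definition fps (K : Type) := nat -> K.

Section FormalPowerSeries.
Variable K : fieldType.
Implicit Types f h : fps K.

Definition fps_one : fps K := fun n => (n == 0%N)%:R.

Definition fps_opp f : fps K := fun n => - f n.

Definition fps_mul f h : fps K := fun n => \sum_(i < n.+1) f i * h (n - i)%N.

Definition fps_pow f (k : nat) : fps K := iter k (fps_mul f) fps_one.

(* exp f = sum_k f^k / k!, for f with zero constant term: x^k then divides
   f^k, so only the terms with k <= n contribute to the coefficient of x^n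
   (see fps_exp_stable). *)
Definition fps_exp f : fps K :=
  fun n => \sum_(k < n.+1) fps_pow f k n / (k`!)%:R.

Lemma fps_pow_small f k n : f 0%N = 0 -> (n < k)%N -> fps_pow f k n = 0.
Proof.
move=> f0; elim: k n => [//|k IHk] n lt_nk.
rewrite /fps_pow iterS -/(fps_pow f k) /fps_mul big1 // => -[[|i] /= lt_in] _.
  by rewrite f0 mul0r.
rewrite IHk ?mulr0 // subnSK //.
by move: lt_nk; rewrite ltnS; apply: leq_trans; apply: leq_subr.
Qed.

Lemma fps_exp_stable f n N : f 0%N = 0 -> (n <= N)%N ->
  \sum_(k < N.+1) fps_pow f k n / (k`!)%:R = fps_exp f n.
Proof.
move=> f0 le_nN; rewrite /fps_exp.
rewrite [RHS](big_ord_widen N.+1 (fun k => fps_pow f k n / (k`!)%:R)) //.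
rewrite [RHS]big_mkcond; apply: eq_bigr => k _.
by case: ltnP => // lt_nk; rewrite fps_pow_small ?mul0r.
Qed.

End FormalPowerSeries.

(* An arithmetic function on the positive integers is a function on nat whose
   value at 0 is never used. *)
Section BellTransform.
Variable R : realType.
Implicit Type g : nat -> R[i].

Definition bell_exponent g (m : nat) : R[i] :=
  m%:R^-1 * \sum_(d <- divisors m) (mobius d)%:~R * g (m %/ d)%N.

Definition bell_log g : fps R[i] :=
  fun n => if n == 0%N then 0 else g n / n%:R.

Definition bell_transform g : fps R[i] := fps_exp (fps_opp (bell_log g)).

End BellTransform.

(* Main.v *)
(* Bell exponents vanishing off the multiples of p force g(m) = 0 for p not
   dividing m, by strong induction: in the sum over d | m the term d = 1 is
   g(m), and the others involve g at proper divisors of m, again prime to p.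
   So the logarithm of F_g is a power series in x^p, hence so is F_g. *)
Require Import Defs.
From mathcomp Require Import all_boot all_order all_algebra.

Import GRing.Theory.

Local Open Scope ring_scope.

Definition supported_on_multiples {K : fieldType} (p : nat) (f : fps K) :=
  forall n : nat, ~~ (p %| n)%N -> f n = 0.

(** If [p] does not divide [n], then in each product [f i * h (n - i)] at least one of the two
    indices is not a multiple of [p]. *)
Lemma fps_mul_supported {K : fieldType} {p : nat} {f h : fps K} :
  supported_on_multiples p f -> supported_on_multiples p h ->
  supported_on_multiples p (fps_mul f h).
Proof.
move=> f_supp h_supp n pNn; apply: big1 => -[i /= le_in] _.
have [p_i|pNi] := boolP (p %| i)%N; last by rewrite f_supp ?mul0r.
by rewrite h_supp ?mulr0 // dvdn_subl.
Qed.

Lemma fps_pow_supported {K : fieldType} {p : nat} {f : fps K} (k : nat) :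
  supported_on_multiples p f -> supported_on_multiples p (fps_pow f k).
Proof.
move=> f_supp; elim: k => [|k IHk]; last exact: fps_mul_supported.
(* Since [p] divides 0, only positive indices remain, and there [fps_one] vanishes. *)
by case=> [|n] //; rewrite dvdn0.
Qed.

Lemma fps_exp_supported {K : fieldType} {p : nat} {f : fps K} :
  supported_on_multiples p f -> supported_on_multiples p (fps_exp f).
Proof.
move=> f_supp n pNn; apply: big1 => k _.
by rewrite (fps_pow_supported k f_supp) ?mul0r.
Qed.

Lemma bell_exponent_eq0_supported {R : realType} {p : nat} {g : nat -> R[i]} :
  (forall m : nat, (0 < m)%N -> ~~ (p %| m)%N -> bell_exponent g m = 0) ->
  supported_on_multiples p g.
Proof.
move=> beta0 m; elim/ltn_ind: m => m IHm pNm.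
have m_gt0 : (0 < m)%N by case: m pNm {IHm} => //; rewrite dvdn0.
have /eqP := beta0 m m_gt0 pNm.
(* In characteristic 0 the factor [m%:R^-1] is nonzero, so the divisor sum itself vanishes. *)
rewrite /bell_exponent mulf_eq0 invr_eq0 Num.Theory.pnatr_eq0 eqn0Ngt m_gt0 /=.
rewrite (bigD1_seq 1%N) ?divisors_uniq -?dvdn_divisors ?dvd1n //=.
rewrite divn1 mul1r big_seq_cond big1 ?addr0 => [/eqP //|d /andP[d_m dN1]].
rewrite -dvdn_divisors // in d_m.
(* Induction applies at [m %/ d]: it is below [m] because [d > 1], and it divides [m], so [p] cannot
   divide it. *)
rewrite IHm ?mulr0 //.
  by rewrite ltn_Pdiv // ltn_neqAle eq_sym dN1 (dvdn_gt0 m_gt0).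
by apply: contra pNm => /dvdn_trans; apply; apply: dvdn_div.
Qed.

Theorem theorem2p7 (R : realType) (p : nat) (g : nat -> R[i]) :
  prime p ->
  (forall m : nat, (0 < m)%N -> ~~ (p %| m)%N -> bell_exponent g m = 0) ->
  forall n : nat, ~~ (p %| n)%N -> bell_transform g n = 0.
Proof.
move=> _ beta0; apply: fps_exp_supported => n pNn.
rewrite /fps_opp /bell_log (bell_exponent_eq0_supported beta0) //.
by rewrite mul0r if_same oppr0.
Qed.
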